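(* Let $T$ be a tree of order $n$ and size $m$. Then $EC(T)=m=n-1$ if and only if $T\in\Phi$, where $\Phi$ denotes the family consisting of all trees of diameter at most $3$, together with all trees of diameter $4$ whose central vertex on every longest path has degree $2$.
   Context: Graphs are finite and simple; the order is the number of vertices and the size is the number of edges. In a tree of diameter $4$ a longest path has the form $v_1v_2v_3v_4v_5$ and its central vertex is $v_3$. Two distinct edges are adjacent if they share an endpoint. A set $D\subseteq E$ is an edge-dominating set of $G=(V,E)$ if every edge in $E\setminus D$ is adjacent to an edge of $D$. Two disjoint sets of edges $E_1,E_2$ form an edge coalition if neither is an edge-dominating set but $E_1\cup E_2$ is. An $ec$-partition of $G$ is a partition $\pi=\{E_1,\ldots,E_k\}$ of $E$ into nonempty sets such that every $E_i$ is either a singleton edge-dominating set, or is not an edge-dominating set but forms an edge coalition with another set $E_j$ of $\pi$. The edge coalition number $EC(G)$ is the maximum order $k$ of an $ec$-partition of $G$. *)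

(* Defs.v *)
From mathcomp Require Import all_boot.

Set Implicit Arguments.
Unset Strict Implicit.
Unset Printing Implicit Defensive.

(* A graph on the finite vertex type T is given by its adjacency relation e. *)

Definition simple_graph (T : finType) (e : rel T) : Prop :=
  symmetric e /\ irreflexive e.

Definition connected (T : finType) (e : rel T) : Prop :=
  forall x y : T, connect e x y.

(* The bound on the size is needed: [:: x; y] with e x y is a ucycle for
   a symmetric e. *)
Definition acyclic (T : finType) (e : rel T) : Prop :=
  forall c : seq T, 2 < size c -> ~ ucycle e c.

Definition is_tree (T : finType) (e : rel T) : Prop :=
  [/\ 0 < #|T|, simple_graph e, connected e & acyclic e].

Definition edge_set (T : finType) (e : rel T) : {set {set T}} :=
  [set [set u.1; u.2] | u : T * T & e u.1 u.2].

Definition degree (T : finType) (e : rel T) (x : T) : nat :=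
  #|[set y | e x y]|.

(* Least length of a walk from x to y; the junk value #|T| is taken exactly
   when there is no such walk. *)
Definition dist (T : finType) (e : rel T) (x y : T) : nat :=
  find (fun k => [exists p : k.-tuple T, path e x p && (last x p == y)])
       (iota 0 #|T|).

Definition diameter (T : finType) (e : rel T) : nat :=
  \max_(x : T) \max_(y : T) dist e x y.

Definition simple_path (T : finType) (e : rel T) (s : seq T) : bool :=
  [&& s != [::], uniq s & sorted e s].

Definition longest_path (T : finType) (e : rel T) (s : seq T) : Prop :=
  simple_path e s /\ forall s' : seq T, simple_path e s' -> size s' <= size s.

Definition edge_adjacent (T : finType) (f g : {set T}) : bool :=
  (f != g) && (f :&: g != set0).

Definition edge_dominating (T : finType) (e : rel T) (D : {set {set T}}) : bool :=
  (D \subset edge_set e) &&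
  [forall f in edge_set e :\: D, [exists g in D, edge_adjacent f g]].

Definition edge_coalition (T : finType) (e : rel T) (A B : {set {set T}}) : bool :=
  [&& A \subset edge_set e, B \subset edge_set e, [disjoint A & B],
      ~~ edge_dominating e A, ~~ edge_dominating e B &
      edge_dominating e (A :|: B)].

Definition ec_partition (T : finType) (e : rel T) (P : {set {set {set T}}}) : bool :=
  partition P (edge_set e) &&
  [forall A in P,
     (#|A| == 1) && edge_dominating e A
     || ~~ edge_dominating e A && [exists B in P :\ A, edge_coalition e A B]].

(* The maximum is 0 when e has no ec-partition. *)
Definition EC (T : finType) (e : rel T) : nat :=
  \max_(P : {set {set {set T}}} | ec_partition e P) #|P|.

Definition Phi (T : finType) (e : rel T) : Prop :=
  is_tree e /\
  (diameter e <= 3 \/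
   diameter e = 4 /\
   forall v1 v2 v3 v4 v5 : T,
     longest_path e [:: v1; v2; v3; v4; v5] -> degree e v3 = 2).

(* Main.v *)
Require Import Defs.
From mathcomp Require Import all_boot.

(** The number of blocks of an ec-partition reaches the number [m] of edges only for the
    partition into singletons, so [EC e = m] says that every edge dominates by itself
    or forms an edge coalition with another edge.

    The two directions meet in the notion of a vertex cover by two vertices.  The trees of
    the family have one: the second and the penultimate vertex of a longest path
    ([Phi_vertex_cover]).  In any graph, if [b] and [c] cover all the edges, then an edge
    [f] at [b] that does not dominate misses some edge [g], which has to be at [c], and
    [{f, g}] dominates ([EC_vertex_cover]).

    Conversely, if [f] has a partner [g], then [g] meets every edge that [f] misses.  In a
    tree no edge joins the two end edges of a path on at least five vertices, so no edge
    missing both of them has a partner ([middle_edge_no_partner]).  A tree of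
    diameter at least 5 has such an edge, the middle one of a path on six vertices, and so
    does a tree of diameter 4 whose centre has a third neighbour ([EC_max_Phi]).

    The equality [m = n - 1] holds in every tree, by sending each vertex other than a
    root to the edge towards its parent ([tree_edge_count]).  All the properties of trees
    rest on one fact: distinct neighbours of a vertex are not connected once this vertex is
    deleted ([acyclic_neighbours]).  Hence paths are unique, [dist] is the length of
    the path, and paths leaving a vertex by different edges can be joined. *)

Set Implicit Arguments.
Unset Strict Implicit.
Unset Printing Implicit Defensive.

(** * Simple paths *)

Lemma simple_path_cons (T : finType) (e : rel T) (x : T) (p : seq T) :
  simple_path e (x :: p) = path e x p && uniq (x :: p).
Proof. by rewrite /simple_path /= andbC. Qed.

Lemma simple_path_rev (T : finType) (e : rel T) (s : seq T) :
  symmetric e -> simple_path e (rev s) = simple_path e s.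
Proof.
move=> sym_e; rewrite /simple_path rev_uniq rev_sorted.
rewrite (@eq_sorted _ _ e) //.
by rewrite -!size_eq0 size_rev.
Qed.

Lemma simple_path_prefix (T : finType) (e : rel T) (x : T) (p q : seq T) :
  simple_path e (x :: p ++ q) -> simple_path e (x :: p).
Proof.
rewrite !simple_path_cons cat_path -cat_cons cat_uniq.
by move=> /andP[/andP[-> _] /andP[-> _]].
Qed.

Lemma simple_path_behead (T : finType) (e : rel T) (x y : T) (p : seq T) :
  simple_path e [:: x, y & p] -> simple_path e (y :: p).
Proof.
by rewrite !simple_path_cons cons_uniq /= => /andP[/andP[_ ->] /andP[_]].
Qed.

(** * Acyclic graphs *)

(** The edges of the graph with the vertex [z] deleted, kept on the same type so that
    [connect] applies. *)
Definition avoid (T : finType) (e : rel T) (z : T) : rel T :=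
  [rel u v | [&& e u v, u != z & v != z]].

Lemma avoid_sym (T : finType) (e : rel T) (z : T) :
  symmetric e -> symmetric (avoid e z).
Proof. by move=> sym_e u v; rewrite /avoid /= sym_e [(u != z) && _]andbC. Qed.

Lemma connect_avoid (T : finType) (e : rel T) (z u v : T) (p : seq T) :
  simple_path e (z :: u :: p) -> v \in u :: p -> connect (avoid e z) u v.
Proof.
rewrite simple_path_cons => /andP[/andP[_ e_p] /andP[z_p _]].
apply: path_connect; elim: p u e_p z_p => //= w p IHp u /andP[e_uw e_p].
rewrite !inE !negb_or => /and3P[zu zw zp].
by rewrite /avoid /= e_uw ![_ == z]eq_sym zu zw IHp //= inE negb_or zw.
Qed.

(** A walk from [a] to [b] that avoids their common neighbour [z] would close up into
    a cycle through [z].  All the other facts about acyclic graphs come from here. *)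
Lemma acyclic_neighbours (T : finType) (e : rel T) (z a b : T) :
    simple_graph e -> acyclic e ->
  e z a -> e z b -> connect (avoid e z) a b -> a = b.
Proof.
move=> [sym_e irr_e] acyc_e e_za e_zb /connectP[q0 q0path b_def].
have neq_nbr u : e z u -> u != z by apply: contraTneq => ->; rewrite irr_e.
move: q0path b_def => /shortenP[q q_path q_uniq _] b_def.
case: q => [|c q] in q_path q_uniq b_def; first by [].
have e_path : path e a (c :: q) by apply: sub_path q_path => u v /and3P[].
have z_q : z \notin c :: q.
  elim: (c :: q) (a) q_path {e_path b_def q_uniq} => //= w r IHr u.
  case/andP=> /and3P[_ _ w_z] /IHr r_z.
  by rewrite inE negb_or r_z eq_sym w_z.
case: (acyc_e [:: z, a, c & q]) => //; apply/andP; split.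
  move: e_path => /=/andP[e_ac e_cq].
  by rewrite /= rcons_path e_za e_ac e_cq (_ : last c q = b) // sym_e.
by rewrite cons_uniq inE negb_or z_q eq_sym neq_nbr.
Qed.

(** At the first vertex [x] where the two paths part, they would leave through distinct
    neighbours of [x] that are joined away from [x] by the rest of the two paths. *)
Lemma simple_path_inj (T : finType) (e : rel T) (x : T) (p q : seq T) :
    simple_graph e -> acyclic e ->
  simple_path e (x :: p) -> simple_path e (x :: q) ->
  last x p = last x q -> p = q.
Proof.
move=> gr_e acyc_e.
elim: p x q => [|a p IHp] x [|b q] //=; rewrite !simple_path_cons.
- by move=> _ /= /and3P[_ /negP x_q _] xE; case: x_q; rewrite xE mem_last.
- by move=> /= /and3P[_ /negP x_p _] _ xE; case: x_p; rewrite -xE mem_last.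
rewrite -!simple_path_cons => xap xbq last_eq.
have a_b : connect (avoid e x) a b.
  apply: connect_trans (connect_avoid xap (mem_last a p)) _.
  rewrite last_eq sym_connect_sym; last exact/avoid_sym/gr_e.1.
  exact: connect_avoid xbq (mem_last b q).
move: xap xbq; rewrite !simple_path_cons /=.
move=> /andP[/andP[e_xa e_p] /andP[_ p_uniq]] /andP[/andP[e_xb e_q] /andP[_ q_uniq]].
have eq_ab := acyclic_neighbours gr_e acyc_e e_xa e_xb a_b.
rewrite -eq_ab in last_eq e_q q_uniq *.
by rewrite (IHp a q) // simple_path_cons ?e_p ?e_q.
Qed.

(** Two paths leaving [z] through distinct neighbours cannot meet again, so they form
    one longer path.  This is what contradicts the maximality of a longest path. *)
Lemma simple_path_join (T : finType) (e : rel T) (z a b : T) (p q : seq T) :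
    simple_graph e -> acyclic e ->
  simple_path e [:: z, a & p] -> simple_path e [:: z, b & q] -> a != b ->
  simple_path e (rev (a :: p) ++ [:: z, b & q]).
Proof.
move=> gr_e acyc_e zap zbq; apply: contra_neqT => not_simple.
have [[v v_p v_q]|disj] : (exists2 v, v \in a :: p & v \in b :: q)
    \/ ~~ has (mem (a :: p)) (b :: q).
- by case: hasP => [[v v_q v_p]|_]; [left; exists v | right].
- have [e_za e_zb] : e z a /\ e z b.
    by move: zap zbq; rewrite !simple_path_cons /= => /andP[/andP[-> _] _] /andP[/andP[-> _] _].
  apply: (acyclic_neighbours gr_e acyc_e e_za e_zb).
  apply: connect_trans (connect_avoid zap v_p) _.
  rewrite sym_connect_sym; last exact/avoid_sym/gr_e.1.
  exact: connect_avoid zbq v_q.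
case/negP: not_simple.
move: zap; rewrite -(simple_path_rev _ gr_e.1) rev_cons => /and3P[_ zap_uniq zap_sorted].
move: zbq; rewrite simple_path_cons cons_uniq => /andP[zbq_path /andP[z_bq bq_uniq]].
rewrite /simple_path -size_eq0 size_cat addnS /= sorted_cat_cons zap_sorted zbq_path !andbT.
rewrite -cat_rcons cat_uniq zap_uniq bq_uniq andbT.
rewrite -rev_cons; apply: contra disj => /hasP[v v_q v_r].
have: v \in rev [:: z, a & p] by [].
rewrite mem_rev inE => /predU1P[v_z|v_p]; last by apply/hasP; exists v.
by rewrite -v_z v_q in z_bq.
Qed.

(** A chord is itself a path with the same ends, so uniqueness of paths excludes it. *)
Lemma simple_path_chordless (T : finType) (e : rel T) (x : T) (p : seq T) :
    simple_graph e -> acyclic e ->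
  simple_path e (x :: p) -> 1 < size p -> ~~ e x (last x p).
Proof.
move=> gr_e acyc_e xp; apply: contraL => e_x.
have x_last : simple_path e [:: x; last x p].
  rewrite simple_path_cons /= e_x inE !andbT.
  by apply: contraTneq e_x => <-; rewrite gr_e.2.
by rewrite -(simple_path_inj gr_e acyc_e x_last xp).
Qed.

(** * Distance and diameter *)

Lemma connected_simple_path (T : finType) (e : rel T) (x y : T) :
  connected e -> exists2 p, simple_path e (x :: p) & last x p = y.
Proof.
move=> conn_e; have /connectP[p0 p0_path ->] := conn_e x y.
by case/shortenP: p0_path => p p_path p_uniq _; exists p; rewrite // simple_path_cons p_path.
Qed.

(** A shorter walk would shorten to a second simple path with the same ends. *)
Lemma dist_simple_path (T : finType) (e : rel T) (x : T) (p : seq T) :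
    simple_graph e -> acyclic e ->
  simple_path e (x :: p) -> dist e x (last x p) = size p.
Proof.
move=> gr_e acyc_e xp; rewrite /dist; set a := (fun k => _).
have p_lt : size p < #|T|.
  move: xp; rewrite simple_path_cons => /andP[_ /card_uniqP/= <-]; exact: max_card.
have a_p : a (size p).
  apply/existsP; exists (in_tuple p); rewrite eqxx andbT.
  by move: xp; rewrite simple_path_cons => /andP[].
have a_ge k : a k -> size p <= k.
  case/existsP => t /andP[t_path /eqP]; case/shortenP: t_path => q q_path q_uniq q_t last_q.
  rewrite -(@simple_path_inj _ e x q p) // ?simple_path_cons ?q_path //.
  by rewrite -(size_tuple t) uniq_leq_size //; case/andP: q_uniq.
have has_a : has a (iota 0 #|T|) by apply/hasP; exists (size p); rewrite // mem_iota.
have find_lt := has_a; rewrite has_find size_iota in find_lt.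
apply/eqP; rewrite eqn_leq; apply/andP; split.
  rewrite leqNgt; apply/negP => /(before_find 0).
  by rewrite nth_iota // add0n a_p.
by apply: a_ge; have := nth_find 0 has_a; rewrite nth_iota // add0n.
Qed.

Lemma size_simple_path_diameter (T : finType) (e : rel T) (s : seq T) :
    simple_graph e -> acyclic e ->
  simple_path e s -> size s <= (diameter e).+1.
Proof.
move=> gr_e acyc_e; case: s => // x p xp.
rewrite /= ltnS -(dist_simple_path gr_e acyc_e xp).
apply: leq_trans (leq_bigmax x); exact: (leq_bigmax (F := dist e x)).
Qed.

(** Together with [size_simple_path_diameter], this identifies the longest paths with
    the paths on [diameter e + 1] vertices. *)
Lemma diameter_simple_path (T : finType) (e : rel T) :
  is_tree e -> exists2 s, simple_path e s & size s = (diameter e).+1.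
Proof.
case=> T_gt0 gr_e conn_e acyc_e.
have [x dx] := eq_bigmax (fun x => \max_y dist e x y) T_gt0.
have [y dy] := eq_bigmax (dist e x) T_gt0.
have [p xp p_last] := connected_simple_path x y conn_e.
exists (x :: p); rewrite //= -(dist_simple_path gr_e acyc_e xp) p_last.
by rewrite /diameter dx dy.
Qed.

(** * Edges and degrees *)

Lemma set2_inj (T : finType) (x y z w : T) :
  [set x; y] = [set z; w] -> x = z /\ y = w \/ x = w /\ y = z.
Proof.
move=> eq_set.
have /set2P x_zw : x \in [set z; w] by rewrite -eq_set set21.
have /set2P y_zw : y \in [set z; w] by rewrite -eq_set set22.
have /set2P z_xy : z \in [set x; y] by rewrite eq_set set21.
have /set2P w_xy : w \in [set x; y] by rewrite eq_set set22.
by case: x_zw z_xy w_xy => ->; case: y_zw => -> [] ? [] ?; auto.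
Qed.

Lemma edge_setP (T : finType) (e : rel T) (f : {set T}) :
  reflect (exists x y, f = [set x; y] /\ e x y) (f \in edge_set e).
Proof.
apply: (iffP imsetP) => [[[x y]]|[x [y [-> e_xy]]]].
  by rewrite inE /= => e_xy ->; exists x, y.
by exists (x, y); rewrite ?inE.
Qed.

Lemma edge_neq0 (T : finType) (e : rel T) (f : {set T}) :
  f \in edge_set e -> f != set0.
Proof. by case/edge_setP=> x [y [-> _]]; apply/set0Pn; exists x; rewrite set21. Qed.

(** The path from [r] to one end of an edge either passes through the other end or
    extends to it; in both cases the edge is the last one of a simple path from [r]. *)
Lemma edge_ends_path (T : finType) (e : rel T) (r x y : T) :
    simple_graph e -> connected e -> e x y ->
  exists p z, [/\ simple_path e (r :: rcons p z),
    [set x; y] = [set z; last r p] & e z (last r p)].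
Proof.
move=> [sym_e irr_e] conn_e e_xy; have [p rp p_last] := connected_simple_path r x conn_e.
have [y_p|y_p] := boolP (y \in r :: p); last first.
  exists p, y; split; rewrite ?p_last 1?setUC 1?sym_e //.
  move: rp; rewrite !simple_path_cons => /andP[p_path p_uniq].
  by rewrite rcons_path p_path p_last e_xy -rcons_cons rcons_uniq y_p.
case/splitPl: y_p => p1 p2 p1_last in rp p_last.
exists p1, x; rewrite p1_last; split=> //.
move: rp; rewrite !simple_path_cons cat_path -cat_cons cat_uniq
  => /andP[/andP[p1_path p2_path] /and3P[p1_uniq p2_p1 _]].
rewrite rcons_path p1_path p1_last sym_e e_xy -rcons_cons rcons_uniq p1_uniq !andbT.
case/lastP: p2 => [|p2 x'] in p_last p2_path p2_p1.
  by move: e_xy; rewrite -p_last cats0 p1_last irr_e.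
move: p_last; rewrite last_cat last_rcons => <-.
by apply: contra p2_p1 => x_p1; rewrite has_rcons /= x_p1.
Qed.

Lemma degree2_neighbours (T : finType) (e : rel T) (v a b w : T) :
  degree e v = 2 -> a != b -> e v a -> e v b -> e v w -> w \in [set a; b].
Proof.
move=> deg2 neq_ab e_va e_vb e_vw.
have /eqP-> : [set a; b] == [set y | e v y]; last by rewrite inE.
rewrite eqEcard cards2 neq_ab -/(degree e v) deg2 andbT.
by apply/subsetP => y /set2P[] ->; rewrite inE.
Qed.

(** * The size of a tree *)

(** Depths along a path from the root grow by one at each step, so an edge traversed last
    by such a path is traversed towards its deeper end. *)
Lemma deeper_end_path (T : finType) (e : rel T) (r z a : T) :
    is_tree e -> e z a -> dist e r z = (dist e r a).+1 ->
  exists2 p, simple_path e (r :: rcons p z) & last r p = a.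
Proof.
case=> _ gr_e conn_e acyc_e e_za depth.
have [p [w [rpw eq_set _]]] := edge_ends_path r gr_e conn_e e_za.
have rp : simple_path e (r :: p) by move: rpw; rewrite -cats1; apply: simple_path_prefix.
have := dist_simple_path gr_e acyc_e rpw; rewrite last_rcons size_rcons.
have := dist_simple_path gr_e acyc_e rp.
case: (set2_inj eq_set) => [][def_z def_a]; first by exists p; rewrite // def_z.
rewrite -def_z -def_a depth => <- /eqP.
by rewrite -addn2 -[X in X == _]addn0 eqn_add2l.
Qed.

(** Once a root [r] is chosen, each other vertex [z] has exactly one neighbour closer to
    [r], its parent, and [z |-> {z, parent z}] is a bijection from the vertices
    other than [r] onto the edges. *)
Lemma tree_edge_count (T : finType) (e : rel T) :
  is_tree e -> #|edge_set e| = #|T| - 1.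
Proof.
move=> tree_e; have [/card_gt0P[r _] gr_e conn_e acyc_e] := tree_e.
pose parent z := odflt r [pick a | e z a && (dist e r z == (dist e r a).+1)].
have parent_unique z a : e z a -> dist e r z = (dist e r a).+1 -> parent z = a.
  move=> e_za depth_a; rewrite /parent; case: pickP => [b|/(_ a)]; last first.
    by rewrite e_za depth_a eqxx.
  case/andP=> e_zb /eqP depth_b /=.
  (* Two parents of [z] would give two paths from [r] to [z]. *)
  have [q rqz <-] := deeper_end_path tree_e e_zb depth_b.
  have [p rpz <-] := deeper_end_path tree_e e_za depth_a.
  have := simple_path_inj gr_e acyc_e rpz rqz; rewrite !last_rcons => /(_ erefl).
  by case/rcons_inj => ->.
have path_parent p z : simple_path e (r :: rcons p z) ->
    [/\ parent z = last r p, e z (parent z) & dist e r z = (dist e r (parent z)).+1].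
  move=> rpz; have rp : simple_path e (r :: p).
    by move: rpz; rewrite -cats1; apply: simple_path_prefix.
  have depth : dist e r z = (dist e r (last r p)).+1.
    have := dist_simple_path gr_e acyc_e rpz; rewrite last_rcons size_rcons => ->.
    by rewrite (dist_simple_path gr_e acyc_e rp).
  have e_zp : e z (last r p).
    by move: rpz; rewrite simple_path_cons rcons_path gr_e.1 => /andP[/andP[]].
  by rewrite (parent_unique z (last r p)).
have parent_edge z : z != r -> e z (parent z) /\ dist e r z = (dist e r (parent z)).+1.
  have [p rp <-] := connected_simple_path r z conn_e.
  case/lastP: p rp => [|p z'] rp; rewrite /= ?eqxx // last_rcons => _.
  by have [] := path_parent _ _ rp.
have -> : edge_set e = [set [set z; parent z] | z in [set~ r]].
  apply/setP => f; apply/edge_setP/imsetP => [[x [y [-> e_xy]]]|[z]].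
    have [p [z [rpz -> _]]] := edge_ends_path r gr_e conn_e e_xy.
    exists z; last by have [-> _ _] := path_parent _ _ rpz.
    move: rpz; rewrite simple_path_cons cons_uniq mem_rcons !inE negb_or eq_sym.
    by case/and3P=> _ /andP[].
  by rewrite !inE => /parent_edge[e_z _] ->; exists z, (parent z).
rewrite card_in_imset ?cardsC1 ?subn1 // => z w; rewrite !inE => z_r w_r eq_set.
case: (set2_inj eq_set) => [][] // def_z def_w.
have := (parent_edge z z_r).2; rewrite def_w (parent_edge w w_r).2 -def_z => /eqP.
by rewrite -addn2 -[X in X == _]addn0 eqn_add2l.
Qed.

(** * Vertex covers of the trees of the family *)

(** The cover consists of the second and the penultimate vertex [b], [c] of a longest path
    [v1 b v3 ...].  An edge avoiding [b] ends a path from [b]; its first step goes to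
    [v3], as otherwise it would extend the longest path beyond [b] on the side
    of [v1].  Extended by [v1], it has no more vertices than the longest one: if those are four,
    the edge is at [c = v3]; if they are five, it is at [v3] or starts at a neighbour of
    [v3] other than [b], which is [c] because [v3] has degree 2. *)
Lemma Phi_vertex_cover (T : finType) (e : rel T) :
  Phi e ->
  exists b c, forall f, f \in edge_set e -> (b \in f) || (c \in f).
Proof.
case=> tree_e diam_e; have [_ gr_e conn_e acyc_e] := tree_e.
have [s s_simple s_size] := diameter_simple_path tree_e.
have longest s' : simple_path e s' -> size s' <= size s.
  by rewrite s_size; apply: size_simple_path_diameter.
have s_le5 : size s <= 5 by rewrite s_size; case: diam_e => [|[-> _]] //; apply: leqW.
have deg2 v1 v2 v3 v4 v5 : s = [:: v1; v2; v3; v4; v5] -> degree e v3 = 2.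
  move=> def_s; case: diam_e => [|[_ deg2]]; first by rewrite -ltnS -s_size def_s.
  by apply: (deg2 v1 v2 v3 v4 v5); split; rewrite -def_s.
clear s_size diam_e.
case: s => [|v1 [|b t]] // in s_simple longest s_le5 deg2 *.
  (* A one-vertex longest path: there are no edges. *)
  exists v1, v1 => _ /edge_setP[x [y [-> e_xy]]].
  suff /longest : simple_path e [:: x; y] by [].
  rewrite simple_path_cons /= e_xy inE !andbT.
  by apply: contraTneq e_xy => ->; rewrite gr_e.2.
exists b, (last v1 (belast b t)) => _ /edge_setP[x [y [-> e_xy]]].
have [p [z [bpz -> e_zp]]] := edge_ends_path b gr_e conn_e e_xy.
case: p bpz e_zp => [|u p] bpz e_zp; first by rewrite set22.
case: t => [|v3 t] in s_simple longest s_le5 deg2 *.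
  by have := longest _ bpz; rewrite /= size_rcons.
move: (s_simple); rewrite simple_path_cons /= => /andP[/and3P[e_v1b e_bv3 t_path]].
rewrite !inE !negb_or => /and3P[/and3P[_ v13 _] /andP[b_v3 b_t] t_uniq].
have bv3 : simple_path e [:: b, v3 & t].
  by rewrite simple_path_cons /= e_bv3 t_path !inE negb_or b_v3 b_t.
(* Leaving [b] away from [v3] would give a path longer than the longest one. *)
have def_u : u = v3.
  apply/eqP/negPn/negP => neq_u.
  have := longest _ (simple_path_join gr_e acyc_e bpz bv3 neq_u).
  by rewrite size_cat size_rev /= size_rcons !addnS !addSn !ltnS ltnNge leq_addl.
rewrite {u}def_u in bpz e_zp *.
have bv1 : simple_path e [:: b; v1].
  rewrite simple_path_cons /= gr_e.1 e_v1b inE !andbT.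
  by apply: contraTneq e_v1b => ->; rewrite gr_e.2.
have v31 : v3 != v1 by rewrite eq_sym.
(* The path through [v3] now bounds [size p], according to the length of [s]. *)
have := longest _ (simple_path_join gr_e acyc_e bpz bv1 v31).
rewrite size_cat size_rev /= size_rcons addn2 !ltnS.
move: t => [|v4 [|v5 [|]]] // in s_simple longest s_le5 deg2 t_path b_t t_uniq bv3 *.
- by rewrite ltnS leqn0 => /nilP->; rewrite /= eqxx !orbT.
have {}deg2 := deg2 _ _ _ _ _ erefl.
have nbr w : e v3 w -> w != b -> w = v4.
  move=> e_v3w /negPf b_w; have : w \in [set b; v4].
    apply: degree2_neighbours deg2 _ _ _ e_v3w.
    - by move: b_t; rewrite inE negb_or => /andP[].
    - by rewrite gr_e.1.
    - by case/andP: t_path.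
  by rewrite !inE b_w => /eqP.
move: bpz e_zp; rewrite simple_path_cons.
case: p => [|w [|]] //= /andP[bp_path bp_uniq] e_zp _.
  have -> : z = v4; last by rewrite eqxx !orbT.
  apply: nbr; first by rewrite gr_e.1.
  by move: bp_uniq; rewrite !inE negb_or [z == b]eq_sym => /andP[/andP[]].
have -> : w = v4; last by rewrite eqxx !orbT.
apply: nbr; first by case/andP: bp_path => _ /andP[].
by move: bp_uniq; rewrite !inE !negb_or [b == w]eq_sym => /andP[/and3P[]].
Qed.

(** * Edge domination and ec-partitions *)

(** Edges are nonempty, so a member of [D] meets itself; hence one condition describes the
    edges inside and outside [D] alike. *)
Lemma edge_dominatingE (T : finType) (e : rel T) (D : {set {set T}}) :
  edge_dominating e D = (D \subset edge_set e) &&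
    [forall f in edge_set e, exists g in D, f :&: g != set0].
Proof.
rewrite /edge_dominating; apply: andb_id2l => D_E.
apply/forall_inP/forall_inP => [dom f f_E | dom f]; last first.
  rewrite inE => /andP[f_D f_E]; have /exists_inP[g g_D fg] := dom f f_E.
  apply/exists_inP; exists g => //; rewrite /edge_adjacent fg andbT.
  by apply: contraNneq f_D => ->.
have [f_D|f_D] := boolP (f \in D).
  by apply/exists_inP; exists f; rewrite ?setIid ?(edge_neq0 f_E).
have /exists_inP[g g_D /andP[_ fg]] : [exists g in D, edge_adjacent f g].
  by apply: dom; rewrite inE f_D.
by apply/exists_inP; exists g.
Qed.

Lemma partition_singletons (T : finType) (A : {set T}) :
  partition [set [set x] | x in A] A.
Proof.
apply/and3P; split.
- rewrite /cover; apply/eqP/setP => x; apply/bigcupP/idP => [[_ /imsetP[y y_A ->]]|x_A].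
    by rewrite inE => /eqP->.
  by exists [set x]; rewrite ?imset_f ?inE.
- apply/trivIsetP => _ _ /imsetP[x _ ->] /imsetP[y _ ->] neq_xy.
  by rewrite disjoints1 inE; apply: contraNneq neq_xy => ->.
- by apply/imsetP => [[x _ /setP/(_ x)]]; rewrite !inE eqxx.
Qed.

(** The sizes of the blocks are at least 1 and sum to the number of blocks. *)
Lemma partition_card_singletons (T : finType) (A : {set T}) (P : {set {set T}}) :
  partition P A -> #|P| = #|A| -> P = [set [set x] | x in A].
Proof.
move=> part_P card_P.
have P_card1 B : B \in P -> #|B| == 1.
  have gt0 B' : B' \in P -> 1 <= #|B'| ?= iff (#|B'| == 1).
    move=> B'_P; apply/leqifP; rewrite -/(_ == _); case: eqP => [->|/eqP ne1] //.
    rewrite ltn_neqAle eq_sym ne1 card_gt0.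
    by apply: contraTneq B'_P => ->; case/and3P: part_P.
  have [_] := leqif_sum gt0; rewrite -(card_partition part_P) sum1_card card_P eqxx.
  by move/esym/forall_inP; apply.
apply/eqP; rewrite eqEcard card_imset ?card_P ?leqnn ?andbT; last exact: set1_inj.
apply/subsetP => B B_P; have /cards1P[x def_B] := P_card1 B B_P.
rewrite def_B imset_f // -(cover_partition part_P).
by apply/bigcupP; exists B; rewrite // def_B inE.
Qed.

Lemma EC_le_size (T : finType) (e : rel T) : EC e <= #|edge_set e|.
Proof.
apply/bigmax_leqP => P /andP[part_P _].
rewrite (card_partition part_P) -sum1_card leq_sum // => B B_P.
by rewrite card_gt0; apply: contraTneq B_P => ->; case/and3P: part_P.
Qed.

(** The partition into singletons works.  Let [f] be an edge that does not dominate, so that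
    some edge [g] misses it.  One of the two cover vertices is in [f], hence not in [g],
    so the other one is in [g]: the edges [f] and [g] contain both cover vertices
    and together meet every edge, whereas neither meets the other. *)
Lemma EC_vertex_cover (T : finType) (e : rel T) (b c : T) :
    (forall f, f \in edge_set e -> (b \in f) || (c \in f)) ->
  EC e = #|edge_set e|.
Proof.
move=> cover_bc; apply/eqP; rewrite eqn_leq EC_le_size /=.
pose P := [set [set f] | f in edge_set e].
rewrite -(card_imset _ (@set1_inj _)) -/P.
apply: leq_bigmax_cond; rewrite /ec_partition partition_singletons /=.
apply/forall_inP => _ /imsetP[f f_E ->]; rewrite cards1 eqxx /=.
have [//|f_dom /=] := boolP (edge_dominating e [set f]).
move: (f_dom); rewrite edge_dominatingE sub1set f_E /= => /forall_inPn[g g_E].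
move=> /exists_inPn/(_ f (set11 f)); rewrite negbK => /eqP gf.
have neq_gf : g != f.
  by apply/eqP => eq_gf; rewrite eq_gf setIid in gf; have := edge_neq0 f_E; rewrite gf eqxx.
have disj v : v \in f -> v \notin g.
  by move=> v_f; apply/negP => v_g; have := in_set0 v; rewrite -gf inE v_f v_g.
apply/exists_inP; exists [set g].
  by rewrite !inE (inj_eq (@set1_inj _)) neq_gf imset_f.
rewrite /edge_coalition !sub1set f_E g_E f_dom disjoints1 inE eq_sym neq_gf /=.
rewrite !edge_dominatingE subUset !sub1set f_E g_E /=; apply/andP; split.
  apply/forall_inPn; exists f => //; apply/exists_inPn => _ /set1P->.
  by rewrite negbK setIC gf.
have meets v (h k : {set T}) : v \in h -> v \in k -> h :&: k != set0.
  by move=> v_h v_k; apply/set0Pn; exists v; rewrite inE v_h.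
apply/forall_inP => h h_E; apply/exists_inP.
have [f_g g_g] : f \in [set f] :|: [set g] /\ g \in [set f] :|: [set g].
  by rewrite !inE !eqxx orbT.
have := cover_bc g g_E; case/orP: (cover_bc f f_E) => v_f.
  rewrite (negPf (disj _ v_f)) /= => c_g.
  by case/orP: (cover_bc h h_E) => v_h; [exists f | exists g] => //; apply: meets v_h _.
rewrite (negPf (disj _ v_f)) orbF => b_g.
by case/orP: (cover_bc h h_E) => v_h; [exists g | exists f] => //; apply: meets v_h _.
Qed.

(** Only the partition into singletons has as many blocks as there are edges.  The case of
    an edge that dominates by itself is covered by [g = f]. *)
Lemma EC_max_pairs (T : finType) (e : rel T) (f : {set T}) :
    EC e = #|edge_set e| -> f \in edge_set e ->
  exists2 g, g \in edge_set e & edge_dominating e [set f; g].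
Proof.
move=> EC_max f_E.
have [P P_ec card_P] : exists2 P, ec_partition e P & #|P| = #|edge_set e|.
  have [/card0_eq no_ec|ec_gt0] := posnP #|ec_partition e|; last first.
    have [P P_ec] := eq_bigmax_cond (fun P : {set {set {set T}}} => #|P|) ec_gt0.
    by rewrite -/(EC e) EC_max => ->; exists P.
  (* Without any ec-partition, [EC e] would be 0, but there is the edge [f]. *)
  have : 0 < #|edge_set e| by rewrite card_gt0; apply/set0Pn; exists f.
  by rewrite -EC_max /EC big_pred0 // => P; exact: no_ec.
have /andP[part_P /forall_inP coal_P] := P_ec.
have def_P := partition_card_singletons part_P card_P.
have /coal_P : [set f] \in P by rewrite def_P imset_f.
case/orP=> [/andP[_ f_dom]|/andP[_ /exists_inP[B /setD1P[_ ]]]].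
  by exists f; rewrite ?setUid.
rewrite def_P => /imsetP[g g_E ->] /and5P[_ _ _ _ /andP[_ fg_dom]].
by exists g.
Qed.

(** * Edges without partner and the characterization *)

(** A partner [g] of an edge [f] that misses both end edges [ab] and [cd] of a path would
    have to meet both, hence to be a chord of the path. *)
Lemma middle_edge_no_partner (T : finType) (e : rel T) (a b c d : T)
    (p : seq T) (f g : {set T}) :
    simple_graph e -> acyclic e ->
    simple_path e [:: a, b & rcons (rcons p c) d] -> p != [::] ->
    (forall v, v \in f -> v \notin [:: a; b; c; d]) -> g \in edge_set e ->
  ~~ edge_dominating e [set f; g].
Proof.
move=> gr_e acyc_e s_path p_neq0 disj /edge_setP[x [y [def_g e_xy]]].
have b_path := simple_path_behead s_path.
have [ac_path bc_path] : simple_path e [:: a, b & rcons p c] /\ simple_path e (b :: rcons p c).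
  split; first by apply: (@simple_path_prefix _ _ _ (b :: rcons p c) [:: d]); rewrite /= cats1.
  by apply: (@simple_path_prefix _ _ _ (rcons p c) [:: d]); rewrite /= cats1.
have p_gt0 : 0 < size p by rewrite lt0n size_eq0.
have far u v : u \in [set a; b] -> v \in [set c; d] -> ~~ e u v.
  case/set2P=> -> /set2P[] ->.
  - by have := simple_path_chordless gr_e acyc_e ac_path; rewrite /= last_rcons size_rcons; apply.
  - by have := simple_path_chordless gr_e acyc_e s_path; rewrite /= last_rcons size_rcons; apply.
  - by have := simple_path_chordless gr_e acyc_e bc_path; rewrite last_rcons size_rcons; apply.
  - by have := simple_path_chordless gr_e acyc_e b_path; rewrite last_rcons !size_rcons; apply.
have [ab_E cd_E e_ab e_cd] :
    [/\ [set a; b] \in edge_set e, [set c; d] \in edge_set e, e a b & e c d].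
  move: s_path; rewrite simple_path_cons /= !rcons_path last_rcons.
  case/andP=> /and3P[e_ab _ e_cd] _.
  by split=> //; apply/edge_setP; [exists a, b | exists c, d].
rewrite edge_dominatingE negb_and; apply/orP; right; apply/negP => /forall_inP dom.
have meets u v : [set u; v] \in edge_set e -> {subset [set u; v] <= [:: a; b; c; d]} ->
    exists2 w, w \in [set u; v] & w \in g.
  move=> uv_E uv_sub; have /exists_inP[h /set2P[] -> /set0Pn[w /setIP[w_uv w_h]]] := dom _ uv_E.
    by have := disj w w_h; rewrite uv_sub.
  by exists w.
have [u u_ab u_g] : exists2 w, w \in [set a; b] & w \in g.
  by apply: meets => // w /set2P[] ->; rewrite !inE eqxx ?orbT.
have [v v_cd v_g] : exists2 w, w \in [set c; d] & w \in g.
  by apply: meets => // w /set2P[] ->; rewrite !inE eqxx ?orbT.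
have neq_uv : u != v.
  apply: contraTneq v_cd => <-; move: s_path; rewrite simple_path_cons => /andP[_].
  rewrite !cons_uniq !(inE, mem_rcons) !negb_or.
  case/and3P=> /and4P[_ ad ac _] /and3P[bd bc _] _.
  by case/set2P: u_ab => ->; rewrite ac ad || rewrite bc bd.
have := far u v u_ab v_cd; rewrite def_g in u_g v_g.
case/set2P: u_g => def_u; case/set2P: v_g => def_v.
- by rewrite def_u def_v eqxx in neq_uv.
- by rewrite def_u def_v e_xy.
- by rewrite def_u def_v gr_e.1 e_xy.
- by rewrite def_u def_v eqxx in neq_uv.
Qed.

(** Beyond diameter 4 the middle edge of a path on six vertices has no partner; in diameter
    4 the same holds for a third edge at the centre [v3]. *)
Lemma EC_max_Phi (T : finType) (e : rel T) :
  is_tree e -> EC e = #|edge_set e| -> Phi e.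
Proof.
move=> tree_e EC_max; split=> //; have [_ gr_e _ acyc_e] := tree_e.
have [|diam_gt3] := leqP (diameter e) 3; [by left | right].
have no_middle a b c d p f : simple_path e [:: a, b & rcons (rcons p c) d] -> p != [::] ->
    f \in edge_set e -> exists2 v, v \in f & v \in [:: a; b; c; d].
  move=> s_path p_neq0 f_E; apply/exists_inP; apply: contraT => /exists_inPn disj.
  have [g g_E fg_dom] := EC_max_pairs EC_max f_E.
  by have := middle_edge_no_partner gr_e acyc_e s_path p_neq0 disj g_E; rewrite fg_dom.
split.
  apply/eqP; rewrite eqn_leq diam_gt3 andbT leqNgt; apply/negP => diam_gt4.
  have [s s_simple s_size] := diameter_simple_path tree_e.
  have {s_size} : 5 < size s by rewrite s_size.
  case: s s_simple => [|v1 [|v2 [|v3 [|v4 [|v5 [|v6 s]]]]]] // s_simple _.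
  have {}s_simple := @simple_path_prefix _ e v1 [:: v2; v3; v4; v5; v6] s s_simple.
  have e34 : [set v3; v4] \in edge_set e.
    apply/edge_setP; exists v3, v4; split=> //.
    by move: s_simple; rewrite simple_path_cons /= => /andP[/and5P[]].
  have [v v34] := @no_middle v1 v2 v5 v6 [:: v3; v4] _ s_simple isT e34.
  move: s_simple; rewrite simple_path_cons => /andP[_].
  by case/set2P: v34 => ->; rewrite !inE => uniq_s /or4P[] /eqP eq_v; move: uniq_s;
    rewrite eq_v /= !inE eqxx ?orbT ?andbF.
move=> v1 v2 v3 v4 v5 [s_simple _]; apply/eqP/negPn/negP => deg_neq2.
move: (s_simple); rewrite simple_path_cons /= !inE !negb_or.
case/andP=> /and5P[e12 e23 e34 e45 _].
case/and5P=> /and4P[v12 v13 v14 v15] /and3P[v23 v24 v25] /andP[v34 v35] v45 _.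
have /subsetPn[w] : ~~ ([set y | e v3 y] \subset [set v2; v4]).
  apply: contra deg_neq2 => nbr_sub; rewrite eqn_leq; apply/andP; split.
    by have := subset_leq_card nbr_sub; rewrite cards2 v24.
  have <- : #|[set v2; v4]| = 2 by rewrite cards2 v24.
  apply: subset_leq_card.
  by apply/subsetP => y /set2P[] ->; rewrite inE // gr_e.1.
rewrite !inE negb_or => e_3w /andP[w2 w4].
have f_E : [set v3; w] \in edge_set e by apply/edge_setP; exists v3, w.
have [v v_f] := @no_middle v1 v2 v4 v5 [:: v3] _ s_simple isT f_E.
have path123 : simple_path e [:: v1; v2; v3].
  by rewrite simple_path_cons /= e12 e23 !inE negb_or v12 v13 v23.
have path345 : simple_path e [:: v3; v4; v5].
  by rewrite simple_path_cons /= e34 e45 !inE negb_or v34 v35 v45.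
have w1 : w != v1.
  apply: contraTneq e_3w => ->; rewrite gr_e.1.
  exact: (simple_path_chordless gr_e acyc_e path123).
have w5 : w != v5.
  apply: contraTneq e_3w => ->.
  exact: (simple_path_chordless gr_e acyc_e path345).
case/set2P: v_f => ->; rewrite !inE.
  by rewrite ![v3 == _]eq_sym (negPf v13) (negPf v23) [v4 == _]eq_sym (negPf v34)
    [v5 == _]eq_sym (negPf v35).
by rewrite (negPf w1) (negPf w2) (negPf w4) (negPf w5).
Qed.

Theorem theorem6p2 (T : finType) (e : rel T) (n m : nat)
  (hT : is_tree e) (hn : #|T| = n) (hm : #|edge_set e| = m) :
  (EC e = m /\ m = n - 1) <-> Phi e.
Proof.
rewrite -hm -hn; split=> [[EC_max _]|Phi_e]; first exact: EC_max_Phi.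
have [b [c cover_bc]] := Phi_vertex_cover Phi_e.
by split; [exact: EC_vertex_cover cover_bc | exact: tree_edge_count].
Qed.
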